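(* Let $R=\bigoplus_{n\in\mathbb{Z}}R_n$ be a $\mathbb{Z}$-graded ring. Let $\mathcal{A}$ be the set of all maximal right ideals $M$ of $R$ such that $R_n\not\subseteq M$ for some nonzero integer $n$, and let $A(R)=\bigcap_{M\in\mathcal{A}}M$ (with $A(R)=R$ if $\mathcal{A}=\emptyset$). Then: (1) $R$ is right quasi-duo if and only if $R_0$ is right quasi-duo and $R/A(R)$ is a commutative ring; (2) $R$ is left quasi-duo if and only if $R_0$ is left quasi-duo and $R/A(R)$ is a commutative ring.
   Context: All rings are associative with identity, not necessarily commutative. A ring is right (left) quasi-duo if every maximal right (left) ideal of it is a two-sided ideal. A $\mathbb{Z}$-graded ring is a ring $R$ with a decomposition $R=\bigoplus_{n\in\mathbb{Z}}R_n$ into additive subgroups such that $R_nR_m\subseteq R_{n+m}$ for all $n,m\in\mathbb{Z}$. For every $\mathbb{Z}$-graded ring, $A(R)$ is a two-sided ideal (it equals $\{r\in R\mid rR_n\subseteq J(R)\text{ for every } n\neq 0\}=\{r\in R\mid R_nr\subseteq J(R)\text{ for every } n\neq 0\}$, where $J(R)$ is the Jacobson radical of $R$), so the quotient ring $R/A(R)$ makes sense. In both (1) and (2), $A(R)$ is defined by means of maximal right ideals. The zero ring is regarded as commutative. *)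

(* Defs.v *)
From HB Require Import structures.
From mathcomp Require Import all_boot all_order all_algebra.
From mathcomp Require Import ring_quotient boolp classical_sets.

Set Implicit Arguments.
Unset Strict Implicit.
Unset Printing Implicit Defensive.

Import GRing.Theory.
Local Open Scope classical_set_scope.
Local Open Scope ring_scope.
Local Open Scope quotient_scope.

(* Rings are [pzRingType]s rather than [nzRingType]s so that the zero ring is
   allowed: the quotient [graded_quotient] below may be zero. *)
Section Ideals.
Variable R : pzRingType.
Implicit Types I M : set R.

Definition right_ideal I :=
  zmod_closed [in I] /\ (forall x r, I x -> I (x * r)).

Definition left_ideal I :=
  zmod_closed [in I] /\ (forall r x, I x -> I (r * x)).

Definition two_sided_ideal I := left_ideal I /\ right_ideal I.

Definition maximal_right_ideal M :=
  [/\ right_ideal M, M <> setT &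
      forall I, right_ideal I -> M `<=` I -> I = M \/ I = setT].

Definition maximal_left_ideal M :=
  [/\ left_ideal M, M <> setT &
      forall I, left_ideal I -> M `<=` I -> I = M \/ I = setT].

End Ideals.

Definition right_quasi_duo (R : pzRingType) :=
  forall M : set R, maximal_right_ideal M -> two_sided_ideal M.

Definition left_quasi_duo (R : pzRingType) :=
  forall M : set R, maximal_left_ideal M -> two_sided_ideal M.

Definition commutative_ring (R : pzRingType) := commutative (@GRing.mul R).

Section QuotientRing.
Variables (R : pzRingType) (I : set R).

Definition ideal_mem of two_sided_ideal I : {pred R} := [in I].

Variable I2 : two_sided_ideal I.

HB.instance Definition _ :=
  GRing.isZmodClosed.Build R (ideal_mem I2) I2.1.1.

(* The library only makes [Quotient.quot] a ring when [R] is commutative and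
   nonzero, so its additive quotient is given a multiplication here. *)
Definition quotient_ring := Quotient.quot (ideal_mem I2).

HB.instance Definition _ := GRing.Zmodule.on quotient_ring.
HB.instance Definition _ := EqQuotient.on quotient_ring.

Definition quotient_one : quotient_ring := lift_cst quotient_ring 1.
Definition quotient_mul := lift_op2 quotient_ring *%R.

Lemma quotient_eqE (x y : R) :
  (\pi_quotient_ring x = \pi_quotient_ring y) <-> I (x - y).
Proof.
split=> [/eqP|Ixy].
  by rewrite -[_ == _](Quotient.idealrBE (ideal_mem I2)) => /set_mem.
apply/eqP; rewrite -[_ == _](Quotient.idealrBE (ideal_mem I2)).
exact/mem_set.
Qed.

Lemma quotient_repr (x : R) : I (repr (\pi_quotient_ring x) - x).
Proof. by apply/quotient_eqE; rewrite reprK. Qed.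

Lemma quotient_piM : {morph \pi_quotient_ring : x y / x * y >-> quotient_mul x y}.
Proof.
move=> x y; unlock quotient_mul; apply/quotient_eqE.
set x' := repr _; set y' := repr _.
have -> : x * y - x' * y' = - ((x' - x) * y') - x * (y' - y).
  by rewrite mulrBl mulrBr !opprB [RHS]addrC addrA subrK.
have [[I0 IB] _] := I2.1.
apply: set_mem; apply: (IB (- _) _); last first.
  by apply/mem_set/(I2.1.2)/quotient_repr.
rewrite -sub0r; apply: IB => //.
by apply/mem_set/(I2.2.2)/quotient_repr.
Qed.

Lemma quotient_mulA : associative quotient_mul.
Proof.
by move=> x y z; rewrite -[x]reprK -[y]reprK -[z]reprK -!quotient_piM mulrA.
Qed.

Lemma quotient_one_pi : quotient_one = \pi_quotient_ring 1.
Proof. by unlock quotient_one. Qed.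

Lemma quotient_mul1 : left_id quotient_one quotient_mul.
Proof.
by move=> x; rewrite quotient_one_pi -[x]reprK -quotient_piM mul1r.
Qed.

Lemma quotient_mulr1 : right_id quotient_one quotient_mul.
Proof.
by move=> x; rewrite quotient_one_pi -[x]reprK -quotient_piM mulr1.
Qed.

Lemma quotient_piD : {morph \pi_quotient_ring : x y / x + y >-> x + y}.
Proof. exact: (Quotient.pi_add (ideal_mem I2)). Qed.

Lemma quotient_mulDl : left_distributive quotient_mul +%R.
Proof.
move=> x y z; rewrite -[x]reprK -[y]reprK -[z]reprK.
by rewrite -!(quotient_piM, quotient_piD) mulrDl.
Qed.

Lemma quotient_mulDr : right_distributive quotient_mul +%R.
Proof.
move=> x y z; rewrite -[x]reprK -[y]reprK -[z]reprK.
by rewrite -!(quotient_piM, quotient_piD) mulrDr.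
Qed.

HB.instance Definition _ := GRing.Zmodule_isPzRing.Build quotient_ring
  quotient_mulA quotient_mul1 quotient_mulr1 quotient_mulDl quotient_mulDr.

End QuotientRing.

(* The last two fields say that [R] is the internal direct sum of the
   [component n]. *)
Record grading (R : pzRingType) := Grading {
  component :> int -> set R;
  component_zmod : forall n, zmod_closed [in component n];
  component_mul : forall m n x y,
    component m x -> component n y -> component (m + n) (x * y);
  component_span : forall x, exists (s : seq int) (f : int -> R),
    [/\ uniq s, forall n, component n (f n) & x = \sum_(n <- s) f n];
  component_free : forall (s : seq int) (f : int -> R),
    uniq s -> (forall n, component n (f n)) -> \sum_(n <- s) f n = 0 ->
    forall n, n \in s -> f n = 0 }.

Section Graded.
Variables (R : pzRingType) (G : grading R).

Lemma component0 n : G n 0.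
Proof. by have [/set_mem] := component_zmod G n. Qed.

Lemma componentB n x y : G n x -> G n y -> G n (x - y).
Proof.
have [_ GB] := component_zmod G n => Gx Gy.
by apply/set_mem/GB; apply/mem_set.
Qed.

Lemma component1 : G 0 1.
Proof.
have [s [f [us Gf one_sum]]] : exists (s : seq int) (f : int -> R),
    [/\ uniq s && (0 \in s), forall n, G n (f n) & 1 = \sum_(n <- s) f n].
  have [s [f [us Gf one_sum]]] := component_span G 1.
  have [s0|s0] := boolP (0 \in s); first by exists s, f; rewrite us.
  exists (0 :: s), (fun n => if n == 0 then 0 else f n); split.
  - by rewrite /= s0 us mem_head.
  - by move=> n; case: eqP => _ //; apply: component0.
  rewrite big_cons eqxx add0r one_sum !big_seq; apply: eq_bigr => n ns.
  by case: eqP ns s0 => // -> ->.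
have /andP[{}us s0] := us.
have f0_hom m x : G m x -> f 0 * x = x.
  move=> Gx.
  pose g k := f (k - m) * x - (if k == m then x else 0).
  have Gg k : G k (g k).
    apply: componentB; last by case: eqP => [->|_] //; apply: component0.
    by rewrite -{1}[k](subrK m); apply: component_mul.
  have um : uniq [seq n + m | n <- s] by rewrite map_inj_uniq //; apply: addIr.
  have g0 : \sum_(k <- [seq n + m | n <- s]) g k = 0.
    rewrite big_map /g sumrB.
    under eq_bigr do rewrite addrK.
    rewrite -mulr_suml -one_sum mul1r.
    under eq_bigr do rewrite -[X in _ == X]add0r (inj_eq (addIr _)).
    rewrite (bigD1_seq 0) //= big1 ?addr0 ?subrr // => n /negPf -> //.
  have ms : m \in [seq n + m | n <- s].
    by apply/mapP; exists 0; rewrite // add0r.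
  have := component_free um Gg g0 ms.
  by rewrite /g eqxx subrr => /eqP; rewrite subr_eq0 => /eqP.
suff <- : f 0 = 1 by [].
have [t [h [_ Gh h_sum]]] := component_span G 1.
rewrite -[f 0]mulr1 h_sum mulr_sumr.
by apply: eq_bigr => n _; apply: f0_hom (Gh n).
Qed.

Definition component0_mem : {pred R} := [in G 0].

Lemma component0_subring : subring_closed component0_mem.
Proof.
split; first exact/mem_set/component1.
  exact: (component_zmod G 0).2.
move=> x y /set_mem Gx /set_mem Gy; apply/mem_set.
by rewrite -[0 : int]add0r; apply: component_mul.
Qed.

Definition degree0_ring : Type := {x : R | x \in component0_mem}.

HB.instance Definition _ := SubChoice.on degree0_ring.
HB.instance Definition _ :=
  GRing.SubChoice_isSubPzRing.Build R component0_mem degree0_ring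
    component0_subring.

Definition graded_family (M : set R) :=
  maximal_right_ideal M /\ exists2 n : int, n != 0 & ~ (G n `<=` M).

(* This is [setT] when [graded_family] is empty. *)
Definition graded_radical : set R := \bigcap_(M in graded_family) M.

Lemma right_ideal_colon (M : set R) s :
  right_ideal M -> right_ideal [set x | M (s * x)].
Proof.
move=> [[M0 MB] MM]; split; first split.
- by apply/mem_set; rewrite /= mulr0; apply/set_mem.
- move=> x y /set_mem /= Mx /set_mem /= My; apply/mem_set => /=.
  by rewrite mulrBr; apply/set_mem/MB; apply/mem_set.
- by move=> x r /= Mx; rewrite mulrA; apply: MM.
Qed.

Lemma right_idealD (M : set R) x y : right_ideal M -> M x -> M y -> M (x + y).
Proof.
move=> [Mz _] Mx My; apply: set_mem.
by apply: (GRing.zmod_closedD Mz).2; apply/mem_set.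
Qed.

Lemma right_idealB (M : set R) x y : right_ideal M -> M x -> M y -> M (x - y).
Proof. by move=> [[_ MB] _] Mx My; apply/set_mem/MB; apply/mem_set. Qed.

Lemma maximal_right_ideal_gen (M : set R) s x :
  maximal_right_ideal M -> ~ M s -> exists r, M (x - s * r).
Proof.
move=> [Mr _ maxM] Ms.
have M0 : M 0 by have [[/set_mem]] := Mr.
pose N := [set x | exists r, M (x - s * r)].
have Nr : right_ideal N.
  split; first split.
  - by apply/mem_set; exists 0; rewrite mulr0 subrr.
  - move=> u v /set_mem[a Ma] /set_mem[b Mb]; apply/mem_set; exists (a - b).
    have -> : u - v - s * (a - b) = (u - s * a) - (v - s * b).
      by rewrite mulrBr !opprB [s * b - s * a]addrC [s * b - v]addrC addrACA.
    exact: right_idealB.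
  - by move=> u a [b Mb]; exists (b * a); rewrite mulrA -mulrBl; apply: Mr.2.
have [] := maxM N Nr.
- by move=> u Mu; exists 0; rewrite mulr0 subr0.
- move=> NM; case: Ms; rewrite -NM; exists 1.
  by rewrite mulr1 subrr.
- by move=> NT; have : N x by rewrite NT.
Qed.

Lemma maximal_right_ideal_colon (M : set R) s :
  maximal_right_ideal M -> ~ M s ->
  maximal_right_ideal [set x | M (s * x)].
Proof.
move=> maxM Ms; have [Mr _ _] := maxM.
split.
- exact: right_ideal_colon.
- by move=> /seteqP[_ /(_ 1 I)]/=; rewrite mulr1.
move=> J Jr MJ; have [JM|] := pselect (J `<=` [set x | M (s * x)]).
  by left; apply/seteqP; split.
move=> /existsNP[j /not_implyP[Jj Mj]]; right.
apply/seteqP; split=> // x _.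
have [r Mr'] := maximal_right_ideal_gen (s * x) maxM Mj.
rewrite -[x](subrK (j * r)); apply: right_idealD => //.
  by apply: MJ => /=; rewrite mulrBr mulrA.
exact: Jr.2.
Qed.

Lemma graded_radical_ideal : two_sided_ideal graded_radical.
Proof.
have zA : zmod_closed [in graded_radical].
  split; first by apply/mem_set => M [[[[/set_mem]]]].
  move=> x y /set_mem Ax /set_mem Ay; apply/mem_set => M AM.
  by apply: right_idealB (Ax M AM) (Ay M AM); case: AM => -[].
split; split=> //; last first.
  by move=> x r Ax M AM; have [[[_ MM] _ _] _] := AM; apply: MM; apply: Ax.
move=> s x Ax M AM; have [maxM [n n0 nM]] := AM.
have [Mr MT _] := maxM.
have [Ms|Ms] := pselect (M s); first exact: Mr.2.
have [[k k0 kM]|allM] :=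
    pselect (exists2 k : int, k != 0 & ~ (G k `<=` [set x | M (s * x)])).
  by apply: (Ax [set x | M (s * x)]); split;
    [exact: maximal_right_ideal_colon | exists k].
(* [s + M] generates [R / M] and is killed by every [R_k], [k != 0]; hence it
   is already generated over [R_0], and [R_n] kills [R / M]. *)
case: nM => y Gy.
have kill k z : k != 0 -> G k z -> M (s * z).
  move=> k0 Gz; apply: contrapT => Mz; apply: allM; exists k => // sub.
  exact: Mz (sub z Gz).
have [r Mr1] := maximal_right_ideal_gen 1 maxM Ms.
have : M (s * r * y).
  have [t [f [_ Gf ->]]] := component_span G r.
  rewrite mulr_sumr mulr_suml; apply: big_ind.
  - by have [[/set_mem]] := Mr.
  - by move=> u v; apply: right_idealD.
  move=> k _; have [->|k0] := eqVneq k 0.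
    by rewrite -mulrA; apply: (kill n) => //; rewrite -[n]add0r; apply: component_mul.
  by apply: Mr.2; apply: kill (Gf k).
move=> Msry; rewrite -[y]mul1r -[1](subrK (s * r)) mulrDl.
by apply: right_idealD => //; apply: Mr.2.
Qed.

Definition graded_quotient : pzRingType := quotient_ring graded_radical_ideal.

End Graded.

(* Main.v *)
Require Import Defs.
From HB Require Import structures.
From mathcomp Require Import all_boot all_order all_algebra.
From mathcomp Require Import boolp classical_sets.

Set Implicit Arguments.
Unset Strict Implicit.
Unset Printing Implicit Defensive.

Import GRing.Theory.
Local Open Scope classical_set_scope.
Local Open Scope ring_scope.
Local Open Scope quotient_scope.

(** Write J for the Jacobson radical, and call the members of [graded_family]
the graded-visible maximal right ideals.

Suppose that R is right quasi-duo. Being right quasi-duo is a comaximality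
property of pairs of elements ([right_quasi_duoP]), and taking parts of degree
0 hands it down to R_0. For the commutativity of R / A(R) it is enough that
c = d e - e d lies in each graded-visible M when d and e are homogeneous.
Every quotient of R by a maximal right ideal is a division ring, so if
1 - a lies in the maximal right ideal M', then a is central modulo M'. One
cannot expect a given M to contain such an element, but M can be exchanged for
another maximal right ideal M' that does, whenever a is homogeneous of nonzero
degree and outside M; moreover M' inherits the homogeneous elements of M
([maximal_right_ideal_through_homogeneous]). This is used twice. If c and a
homogeneous z of nonzero degree lie outside M, then a product w of c and powers
of z has nonzero degree, and an exchange gives M0 with w = 1 modulo M0; hence w
commutes, modulo M0 and so modulo later exchanges, with homogeneous elements.
A second exchange, for a = w^q d, gives M1 with a = 1 modulo M1. There a
commutes with e, thus w^q c = 0 modulo M1, and so w and a are 0 modulo M1,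
which is absurd ([homogeneous_commutator_mem]).

Conversely, a graded-visible M contains all commutators, hence is two-sided,
and any other M contains every R_n with n <> 0, so that it is controlled by
its degree 0 part ([right_quasi_duo_of_degree0]).

The left-handed equivalence is the right-handed one for the converse ring, with
the same components. What remains is that A(R) does not depend on the side
([graded_radical_converse]): A(R) consists of the elements c with c R_n inside
J for all n <> 0, and also of those with R_n c inside J, while J is the same
on both sides ([jacobson_radical_right_left]). *)

(** * Maximal one-sided ideals *)

Section MaximalIdeals.
Variable R : pzRingType.
Implicit Types (I M : set R) (r x y z : R).

Lemma right_idealP I :
    I 0 -> (forall x y, I x -> I y -> I (x - y)) ->
    (forall x r, I x -> I (x * r)) ->
  right_ideal I.
Proof.
move=> I0 IB IM; split=> //; split=> [|x y /set_mem Ix /set_mem Iy].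
  exact/mem_set.
exact/mem_set/IB.
Qed.

Lemma right_ideal0 I : right_ideal I -> I 0.
Proof. by case=> -[/set_mem]. Qed.

Lemma right_ideal_sum I (K : Type) (s : seq K) (P : pred K) (f : K -> R) :
  right_ideal I -> (forall k, P k -> I (f k)) -> I (\sum_(k <- s | P k) f k).
Proof.
move=> Ir If; apply: big_ind => //; first exact: right_ideal0.
by move=> x y; apply: right_idealD.
Qed.

Lemma right_ideal_eq1 I : right_ideal I -> I 1 -> I = setT.
Proof.
by move=> Ir I1; apply/seteqP; split=> // x _; rewrite -[x]mul1r; apply: Ir.2.
Qed.

Lemma exists_maximal_right_ideal I :
  right_ideal I -> ~ I 1 -> exists2 M, maximal_right_ideal M & I `<=` M.
Proof.
move=> Ir I1.
(* Sets are joined to [I] so that the empty chain has an upper bound too. *)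
pose P (A : set R) := right_ideal (I `|` A) /\ ~ (I `|` A) 1.
have chainP (F : set (set R)) :
    F `<=` P -> total_on F subset -> P (\bigcup_(X in F) X).
  move=> FP Ftot.
  have common x y : (I `|` \bigcup_(X in F) X) x ->
      (I `|` \bigcup_(X in F) X) y ->
      (I x /\ I y) \/ exists X, [/\ F X, (I `|` X) x & (I `|` X) y].
    move=> [Ix|[X FX Xx]] [Iy|[Y FY Yy]].
    - by left.
    - by right; exists Y; split=> //; [left|right].
    - by right; exists X; split=> //; [right|left].
    right; have [XY|YX] := Ftot X Y FX FY.
    - by exists Y; split=> //; right=> //; apply: XY.
    - by exists X; split=> //; right=> //; apply: YX.
  split; last by case=> // -[X FX X1]; apply: (FP X FX).2; right.
  apply: right_idealP.
  - by left; apply: right_ideal0.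
  - move=> x y Ux Uy; have [[Ix Iy]|[X [FX Xx Xy]]] := common x y Ux Uy.
      by left; apply: right_idealB.
    have [IB|XB] := right_idealB (FP X FX).1 Xx Xy; first by left.
    by right; exists X.
  - move=> x r [Ix|[X FX Xx]]; first by left; apply: Ir.2.
    have [|XM|XM] := (FP X FX).1.2 x r; [by right|by left|].
    by right; exists X.
have [A [[Mr M1] maxA]] := Zorn_bigcup chainP.
exists (I `|` A); last by move=> x; left.
split=> // [MT|J Jr MJ]; first by apply: M1; rewrite MT.
have [J1|J1] := pselect (J 1); first by right; apply: right_ideal_eq1.
left; apply/seteqP; split=> //.
have IJ : I `|` J = J.
  by apply/seteqP; split=> x; [case=> // Ix; apply: MJ; left | right].
apply: contrapT => JM; apply: (maxA J); last by rewrite /P IJ.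
split=> [x Ax|JA]; first by apply: MJ; right.
by apply: JM => x Jx; right; apply: JA.
Qed.

Lemma maximal_right_ideal1 M : maximal_right_ideal M -> ~ M 1.
Proof. by case=> Mr MT _ /(right_ideal_eq1 Mr). Qed.

Lemma right_invertible_or_maximal x :
  (exists r, x * r = 1) \/ exists2 M, maximal_right_ideal M & M x.
Proof.
have [|nx] := pselect (exists r, x * r = 1); [by left|right].
pose I := [set y | exists r, x * r = y].
have [|M maxM subM] := @exists_maximal_right_ideal I _ nx.
  apply: right_idealP.
  - by exists 0; rewrite mulr0.
  - by move=> _ _ [a <-] [b <-]; exists (a - b); rewrite mulrBr.
  - by move=> _ r [a <-]; exists (a * r); rewrite mulrA.
by exists M => //; apply: subM; exists 1; rewrite mulr1.
Qed.

(** The quotient of [R] by a two-sided maximal right ideal is a division ring,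
hence a domain. *)
Lemma maximal_prime M x y :
  maximal_right_ideal M -> left_ideal M -> M (x * y) -> M x \/ M y.
Proof.
move=> maxM Ml Mxy; have [My|My] := pselect (M y); [by right|left].
have [Mr _ _] := maxM; have [s Ms] := maximal_right_ideal_gen 1 maxM My.
have -> : x = x * (1 - y * s) + x * y * s by rewrite mulrBr mulr1 mulrA subrK.
by apply: right_idealD => //; [apply: Ml.2|apply: Mr.2].
Qed.

Lemma maximal_prime_exp M x k :
  maximal_right_ideal M -> left_ideal M -> M (x ^+ k) -> M x.
Proof.
move=> maxM Ml; elim: k => [|k IHk]; first by move/(maximal_right_ideal1 maxM).
by rewrite exprS => /(maximal_prime maxM Ml)[].
Qed.

(** If [x] and [1 - y * x] lie in a two-sided maximal right ideal, so does 1;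
conversely, when [M] contains [x] but not [y * x], some [1 - y * x * r] lies
in [M] together with [x * r]. Free of ideals, this form of the property can be
compared between [R] and the ring of degree 0. *)
Lemma right_quasi_duoP :
  right_quasi_duo R <-> forall x y, exists u v, x * u + (1 - y * x) * v = 1.
Proof.
split=> [duoR x y|xyP M maxM].
  pose I := [set r | exists u v, x * u + (1 - y * x) * v = r].
  apply: contrapT => I1.
  have [|M maxM IM] := @exists_maximal_right_ideal I _ I1.
    apply: right_idealP.
    - by exists 0, 0; rewrite !mulr0 addr0.
    - move=> _ _ [a [b <-]] [c [d <-]]; exists (a - c), (b - d).
      by rewrite !mulrBr opprD addrACA.
    - move=> _ r [a [b <-]]; exists (a * r), (b * r).
      by rewrite [RHS]mulrDl !mulrA.
  have [Ml Mr] := duoR M maxM; apply: (maximal_right_ideal1 maxM).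
  rewrite -[1](subrK (y * x)); apply: right_idealD => //.
    by apply: IM; exists 0, 1; rewrite mulr0 add0r mulr1.
  by apply: Ml.2; apply: IM; exists 1, 0; rewrite mulr0 addr0 mulr1.
have [Mr _ _] := maxM; split=> //; split=> [|y x Mx]; first exact: Mr.1.
apply: contrapT => Myx; have [r Myxr] := maximal_right_ideal_gen 1 maxM Myx.
have [u [v uv1]] := xyP (x * r) y.
apply: (maximal_right_ideal1 maxM); rewrite -uv1.
by apply: right_idealD => //; apply: Mr.2; [apply: Mr.2|rewrite mulrA].
Qed.

Lemma maximal_left_ideal_converse M :
  maximal_left_ideal M <-> maximal_right_ideal (R := R^c) M.
Proof.
have leftE I : left_ideal I <-> right_ideal (R := R^c) I.
  by split=> -[Iz IM]; split=> // x y; apply: IM.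
by split=> -[/leftE Ml MT maxM]; split=> // I /leftE; apply: maxM.
Qed.

Lemma left_quasi_duo_converse : left_quasi_duo R <-> right_quasi_duo R^c.
Proof.
by split=> duoR M /maximal_left_ideal_converse /duoR [[Mz Ml] [_ Mr]];
  split; split=> // x y; [apply: Mr|apply: Ml|apply: Mr|apply: Ml].
Qed.

(** The Jacobson radical is left-right symmetric: if the maximal left ideal [L]
misses [x], it contains some [1 - r * x]. As [r * x] is in the right radical,
[1 - r * x] is invertible on the right, and so is its inverse; therefore
[1 - r * x] is a unit, which [L] cannot contain. *)
Lemma jacobson_radical_right_left x :
    (forall M, maximal_right_ideal M -> M x) ->
  forall L, maximal_left_ideal L -> L x.
Proof.
move=> Jx L maxL; apply: contrapT => Lx; have [Ll LT _] := maxL.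
have [r Lrx] : exists r, L (1 - r * x).
  move/maximal_left_ideal_converse: maxL => maxL.
  exact: maximal_right_ideal_gen 1 maxL Lx.
pose y := r * x; have Jy M : maximal_right_ideal M -> M y.
  move=> maxM; have [Mr _ _] := maxM; have [Mr'|Mr'] := pselect (M r).
    exact: Mr.2.
  exact: Jx (maximal_right_ideal_colon maxM Mr').
have [u yu1] : exists u, (1 - y) * u = 1.
  have [//|[M maxM My1]] := right_invertible_or_maximal (1 - y).
  case: (maximal_right_ideal1 maxM); rewrite -[1](subrK y).
  by apply: right_idealD => //; [case: maxM|apply: Jy].
have [v uv1] : exists v, u * v = 1.
  have [//|[M maxM Mu]] := right_invertible_or_maximal u.
  case: (maximal_right_ideal1 maxM); rewrite -yu1 mulrBl mul1r.
  have [Mr _ _] := maxM; apply: right_idealB => //.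
  by apply: Mr.2; apply: Jy.
have vE : v = 1 - y by rewrite -[v]mul1r -[X in X * v]yu1 -mulrA uv1 mulr1.
apply: LT; apply/seteqP; split=> // t _.
by rewrite -[t]mulr1 -uv1 vE mulrA; apply: Ll.2.
Qed.

End MaximalIdeals.

(** * Homogeneous parts *)

Section HomogeneousParts.
Variables (R : pzRingType) (G : grading R).
Implicit Types (x y a : R) (m n : int) (f g : int -> R).

Definition homogeneous_decomposition x f :=
  (forall n, G n (f n)) /\
  exists s : seq int,
    [/\ uniq s, forall n, n \notin s -> f n = 0 & x = \sum_(n <- s) f n].

Lemma homogeneous_decomposition_exists x :
  exists f, homogeneous_decomposition x f.
Proof.
have [s [f [us Gf ->]]] := component_span G x.
exists (fun n => if n \in s then f n else 0); split=> [n|].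
  by case: ifP => // _; apply: component0.
exists s; split=> // [n /negPf->//|].
by rewrite !big_seq; apply: eq_bigr => n ->.
Qed.

Lemma sum_support (s t : seq int) f :
    uniq s -> uniq t -> {subset s <= t} -> (forall n, n \notin s -> f n = 0) ->
  \sum_(n <- t) f n = \sum_(n <- s) f n.
Proof.
move=> us ut st f0.
rewrite (bigID [in s]) /= [X in _ + X]big1 ?addr0; last by move=> n /f0.
rewrite -big_filter; apply: perm_big; apply: uniq_perm; rewrite ?filter_uniq //.
by move=> n; rewrite mem_filter andb_idr //; apply: st.
Qed.

Lemma homogeneous_decompositionB x y f g :
    homogeneous_decomposition x f -> homogeneous_decomposition y g ->
  homogeneous_decomposition (x - y) (fun n => f n - g n).
Proof.
move=> [Gf [s [us f0 ->]]] [Gg [t [ut g0 ->]]]; split=> [n|].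
  exact: componentB.
exists (undup (s ++ t)); split=> [|n|].
- exact: undup_uniq.
- by rewrite mem_undup mem_cat negb_or => /andP[/f0-> /g0->]; rewrite subr0.
rewrite sumrB; congr (_ - _); symmetry;
  apply: sum_support; rewrite ?undup_uniq // => n;
  by rewrite mem_undup mem_cat => ->; rewrite ?orbT.
Qed.

Lemma homogeneous_decomposition_unique x f g :
  homogeneous_decomposition x f -> homogeneous_decomposition x g -> f =1 g.
Proof.
move=> fP gP n; have [Gh [s [us h0]]] := homogeneous_decompositionB fP gP.
rewrite subrr => sum0; apply/eqP; rewrite -subr_eq0; apply/eqP.
have [ns|/h0//] := boolP (n \in s).
exact: (component_free us Gh).
Qed.

Definition homogeneous_part n x :=
  sval (cid (homogeneous_decomposition_exists x)) n.

Lemma homogeneous_partP x :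
  homogeneous_decomposition x (homogeneous_part ^~ x).
Proof. exact: svalP (cid (homogeneous_decomposition_exists x)). Qed.

Lemma homogeneous_partE x f n :
  homogeneous_decomposition x f -> homogeneous_part n x = f n.
Proof.
move=> xf.
exact: (homogeneous_decomposition_unique (homogeneous_partP x) xf n).
Qed.

Lemma component_homogeneous_part n x : G n (homogeneous_part n x).
Proof. exact: (homogeneous_partP x).1. Qed.

Lemma homogeneous_part_is_zmod_morphism n : zmod_morphism (homogeneous_part n).
Proof.
move=> x y; apply: (homogeneous_partE n (homogeneous_decompositionB _ _));
  exact: homogeneous_partP.
Qed.

HB.instance Definition _ n :=
  GRing.isZmodMorphism.Build R R (homogeneous_part n)
    (homogeneous_part_is_zmod_morphism n).

Lemma homogeneous_part_sum x :
  exists s : seq int, x = \sum_(n <- s) homogeneous_part n x.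
Proof. by have [_ [s [_ _]]] := homogeneous_partP x; exists s. Qed.

Lemma homogeneous_part_component m n a :
  G m a -> homogeneous_part n a = if n == m then a else 0.
Proof.
move=> Ga; rewrite (@homogeneous_partE _ (fun k => if k == m then a else 0)) //.
split=> [k|]; first by case: eqP => [->|_] //; apply: component0.
exists [:: m]; split=> // [k|]; last by rewrite big_seq1 eqxx.
by rewrite inE => /negPf->.
Qed.

Lemma homogeneous_partMl m n a x :
  G m a -> homogeneous_part n (a * x) = a * homogeneous_part (n - m) x.
Proof.
move=> Ga.
rewrite (@homogeneous_partE _ (fun k => a * homogeneous_part (k - m) x)) //.
have [Gx [s [us x0 {1}->]]] := homogeneous_partP x; split=> [k|].
  by rewrite -{1}[k](subrK m) addrC; apply: component_mul.
exists [seq k + m | k <- s]; split=> [|k ks|].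
- by rewrite map_inj_uniq //; apply: addIr.
- rewrite x0 ?mulr0 //; apply: contra ks => ks; apply/mapP.
  by exists (k - m); rewrite // subrK.
by rewrite mulr_sumr big_map; under [RHS]eq_bigr do rewrite addrK.
Qed.

Lemma homogeneous_partMr m n a x :
  G m a -> homogeneous_part n (x * a) = homogeneous_part (n - m) x * a.
Proof.
move=> Ga.
rewrite (@homogeneous_partE _ (fun k => homogeneous_part (k - m) x * a)) //.
have [Gx [s [us x0 {1}->]]] := homogeneous_partP x; split=> [k|].
  by rewrite -{1}[k](subrK m); apply: component_mul.
exists [seq k + m | k <- s]; split=> [|k ks|].
- by rewrite map_inj_uniq //; apply: addIr.
- rewrite x0 ?mul0r //; apply: contra ks => ks; apply/mapP.
  by exists (k - m); rewrite // subrK.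
by rewrite mulr_suml big_map; under [RHS]eq_bigr do rewrite addrK.
Qed.

(** The vanishing degree must be strictly beyond 0 on the side of [m], so that
parts can be traced back from it towards degree 0. *)
Lemma homogeneous_part_eventually0 m x :
  m != 0 -> exists k : nat, homogeneous_part (m *+ k.+1) x = 0.
Proof.
move=> m0; have [_ [s [_ x0 _]]] := homogeneous_partP x.
apply: contrapT => /forallNP allk.
pose multiples := [seq m *+ k.+1 | k <- iota 0 (size s).+1].
have um : uniq multiples.
  by rewrite map_inj_uniq ?iota_uniq // => k l /(Num.Theory.mulrIn m0) [].
have : {subset multiples <= s}.
  move=> _ /mapP[k _ ->]; apply: contrapT => /negP ks.
  exact: allk k (x0 _ ks).
by move=> /(uniq_leq_size um); rewrite size_map size_iota ltnn.
Qed.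

Lemma component_exp m a k : G m a -> G (m *+ k) (a ^+ k).
Proof.
move=> Ga; elim: k => [|k IHk]; first exact: component1.
by rewrite exprS mulrS; apply: component_mul.
Qed.

End HomogeneousParts.

(** * Maximal right ideals of a graded ring *)

Section GradedMaximalIdeals.
Variables (R : pzRingType) (G : grading R).
Implicit Types (M : set R) (x y z a c d e : R) (m n i j : int).

Local Notation part := (homogeneous_part G).

(** The elements all of whose parts lie in [M] form the largest graded right
ideal inside [M]. *)
Lemma homogeneous_partsM M x r : right_ideal M ->
  (forall n, M (part n x)) -> forall n, M (part n (x * r)).
Proof.
move=> Mr Mx n; have [s ->] := homogeneous_part_sum G r.
rewrite mulr_sumr raddf_sum; apply: right_ideal_sum => // k _ /=.
rewrite (homogeneous_partMr _ _ (component_homogeneous_part G k r)).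
exact: Mr.2.
Qed.

(** Modulo the largest graded ideal inside [M], which is prime on homogeneous
elements, [1 - a] has no right inverse: comparing degrees, such an inverse
would have to be the geometric series in [a], which is finite only if [a] is
nilpotent, and [a] is not since it is outside [M]. So [1 - a] and that graded
ideal generate a proper right ideal. *)
Lemma maximal_right_ideal_through_homogeneous M m a :
    maximal_right_ideal M -> left_ideal M -> m != 0 -> G m a -> ~ M a ->
  exists M', [/\ maximal_right_ideal M', M' (1 - a) &
                 forall n x, G n x -> M x -> M' x].
Proof.
move=> maxM Ml m0 Ga nMa; have [Mr _ _] := maxM.
pose I := [set x | exists v, forall n, M (part n (x - (1 - a) * v))].
have Ir : right_ideal I.
  apply: right_idealP.
  - by exists 0 => n; rewrite mulr0 subrr raddf0; apply: right_ideal0.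
  - move=> x y [u Mu] [v Mv]; exists (u - v) => n.
    have -> : x - y - (1 - a) * (u - v) =
              (x - (1 - a) * u) - (y - (1 - a) * v).
      by rewrite mulrBr !opprB addrACA [RHS]addrACA [- y - _]addrC.
    by rewrite raddfB; apply: right_idealB (Mu n) (Mv n).
  - move=> x r [v Mv]; exists (v * r) => n.
    by rewrite mulrA -mulrBl; apply: homogeneous_partsM.
have I1 : ~ I 1.
  move=> [v Mv].
  have {}Mv n : M ((if n == 0 then 1 else 0) - part n v + a * part (n - m) v).
    have := Mv n; rewrite mulrBl mul1r opprB addrCA addrC raddfD raddfB /=.
    by rewrite (homogeneous_part_component _ (component1 G))
               (homogeneous_partMl _ _ Ga).
  have Mstep n : n != 0 -> M (part (n - m) v) -> M (part n v).
    move=> /negPf n0 Mn; have := Mv n; rewrite n0 sub0r => Mn'.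
    have := right_idealB Mr (Ml.2 a _ Mn) Mn'.
    by rewrite opprD opprK addrCA subrr addr0.
  (* [v] has no parts in degrees far below 0; the recurrence climbs from there
     up to degree [- m]. *)
  have Mneg : M (part (- m) v).
    have [k vk0] : exists k : nat, part ((- m) *+ k.+1) v = 0.
      by apply: homogeneous_part_eventually0; rewrite oppr_eq0.
    have {vk0}: M (part ((- m) *+ k.+1) v) by rewrite vk0; apply: right_ideal0.
    elim: k => [//|k IHk] Mk; apply: IHk; apply: Mstep.
      by rewrite Num.Theory.mulrn_eq0 oppr_eq0.
    by rewrite -mulrSr.
  (* From degree 0 upwards the parts of [v] are powers of [a]. *)
  have Mpos (k : nat) : M (a ^+ k - part (m *+ k) v).
    elim: k => [|k IHk].
      have := Mv 0; rewrite eqxx sub0r => Mv0.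
      have := right_idealB Mr Mv0 (Ml.2 a _ Mneg).
      by rewrite addrK.
    have := Mv (m *+ k.+1).
    rewrite Num.Theory.mulrn_eq0 (negPf m0) /= sub0r mulrSr addrK => Mk.
    have := right_idealD Mr (Ml.2 a _ IHk) Mk.
    by rewrite mulrBr -exprS addrACA [- (a * _) + _]addrC subrr addr0.
  have [k vk0] := homogeneous_part_eventually0 G v m0.
  have := Mpos k.+1; rewrite vk0 subr0 => /(maximal_prime_exp maxM Ml).
  exact: nMa.
have [M' maxM' IM'] := exists_maximal_right_ideal Ir I1.
exists M'; split=> // [|n x Gx Mx]; apply: IM'.
  by exists 1 => n; rewrite mulr1 subrr raddf0; apply: right_ideal0.
exists 0 => k; rewrite mulr0 subr0 (homogeneous_part_component _ Gx).
by case: eqP => // _; apply: right_ideal0.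
Qed.

Lemma mulrn_addr_neq0 n i : n != 0 -> exists k : nat, n *+ k.+1 + i != 0.
Proof.
move=> n0; have [n_i|] := eqVneq (n *+ 1 + i) 0; last by exists 0.
by exists 1; rewrite mulrS -addrA n_i addr0.
Qed.

Lemma exp_congruent1 M w k :
  two_sided_ideal M -> M (1 - w) -> M (1 - w ^+ k).
Proof.
move=> [Ml Mr] Mw; elim: k => [|k IHk].
  by rewrite subrr; apply: right_ideal0.
have -> : 1 - w ^+ k.+1 = (1 - w) + w * (1 - w ^+ k).
  by rewrite exprS mulrBr mulr1 addrA subrK.
by apply: right_idealD => //; apply: Ml.2.
Qed.

Lemma congruent1_commutes M a x :
  two_sided_ideal M -> M (1 - a) -> M (a * x - x * a).
Proof.
move=> [Ml Mr] Ma.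
have -> : a * x - x * a = x * (1 - a) - (1 - a) * x.
  by rewrite mulrBr mulrBl mulr1 mul1r opprB [RHS]addrC addrA subrK.
by apply: right_idealB; [|apply: Ml.2|apply: Mr.2].
Qed.

Lemma homogeneous_commutator_mem M n z i d j e :
    right_quasi_duo R -> maximal_right_ideal M ->
    n != 0 -> G n z -> ~ M z -> G i d -> G j e ->
  M (d * e - e * d).
Proof.
move=> duoR maxM n0 Gz Mz Gd Ge; apply: contrapT => Mc.
have [Ml Mr] := duoR M maxM; set c := d * e - e * d in Mc.
have Gc : G (i + j) c.
  by apply: componentB; [|rewrite addrC]; apply: component_mul.
(* A second factor [z] is for the case where [c * z] has degree 0; the same
   precaution is taken with [q] below. *)
have [p N0] := mulrn_addr_neq0 (i + j) n0.
set N := _ + _ in N0; pose w := c * z ^+ p.+1.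
have Gw : G N w.
  by rewrite /N addrC; apply: component_mul => //; apply: component_exp.
have Mw : ~ M w.
  by case/(maximal_prime maxM Ml) => // /(maximal_prime_exp maxM Ml).
have [M0 [maxM0 M0w _]] :=
  maximal_right_ideal_through_homogeneous maxM Ml N0 Gw Mw.
have [M0l M0r] := duoR M0 maxM0.
have M0n1 := maximal_right_ideal1 maxM0.
have [q Nq0] := mulrn_addr_neq0 i N0; pose W := w ^+ q.+1; pose a := W * d.
have M0W : M0 (1 - W) by apply: exp_congruent1.
have GW : G (N *+ q.+1) W by apply: component_exp.
have Ga : G (N *+ q.+1 + i) a by apply: component_mul.
have M0d : ~ M0 d.
  move=> M0d; apply: M0n1; rewrite -[1](subrK w).
  apply: right_idealD => //; apply: M0r.2.
  by apply: right_idealB => //; [apply: M0r.2|apply: M0l.2].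
have M0a : ~ M0 a.
  case/(maximal_prime maxM0 M0l) => // M0W'; apply: M0n1.
  by rewrite -[1](subrK W); apply: right_idealD.
have [M1 [maxM1 M1a subM1]] :=
  maximal_right_ideal_through_homogeneous maxM0 M0l Nq0 Ga M0a.
have [M1l M1r] := duoR M1 maxM1.
(* [w] is not congruent to 1 modulo [M1], but the commutators of its powers with
   [e] are homogeneous elements of [M0], and these survive in [M1]. *)
have M1We : M1 (W * e - e * W).
  apply: (subM1 (N *+ q.+1 + j)); last exact: congruent1_commutes.
  by apply: componentB; [|rewrite addrC]; apply: component_mul.
have M1Wc : M1 (W * c).
  have -> : W * c = (a * e - e * a) - (W * e - e * W) * d.
    by rewrite /c /a mulrBr mulrBl !mulrA opprB addrA subrK.
  by apply: right_idealB; [|apply: congruent1_commutes|apply: M1r.2].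
have M1w : M1 w.
  apply: (maximal_prime_exp (k := q.+2) maxM1 M1l).
  by rewrite exprSr /w mulrA -/w -/W; apply: M1r.2.
apply: (maximal_right_ideal1 maxM1); rewrite -[1](subrK a).
apply: right_idealD => //; rewrite /a /W exprS -mulrA.
exact: M1r.2.
Qed.

Lemma right_quasi_duo_commutator M x y :
  right_quasi_duo R -> graded_family G M -> M (x * y - y * x).
Proof.
move=> duoR [maxM [n n0 /existsNP[z /not_implyP[Gz Mz]]]].
have [Mr _ _] := maxM.
have [s ->] := homogeneous_part_sum G x.
have [t ->] := homogeneous_part_sum G y.
rewrite mulr_suml mulr_sumr -sumrB; apply: right_ideal_sum => // i _.
rewrite mulr_suml mulr_sumr -sumrB; apply: right_ideal_sum => // j _.
by apply: (homogeneous_commutator_mem duoR maxM n0 Gz Mz);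
  apply: component_homogeneous_part.
Qed.

(** The property of [right_quasi_duoP] for the ring of degree 0, written with
elements of [R]. The components of the converse ring are the same sets, so this
form also serves the left-handed case, whereas the degree 0 rings of [R] and of
its converse are two different ring structures. *)
Definition degree0_right_comaximal :=
  forall x y, G 0 x -> G 0 y ->
    exists u v, [/\ G 0 u, G 0 v & x * u + (1 - y * x) * v = 1].

Lemma right_quasi_duo_degree0 : right_quasi_duo R -> degree0_right_comaximal.
Proof.
move=> /right_quasi_duoP xyP x y Gx Gy; have [u [v uv1]] := xyP x y.
exists (part 0 u), (part 0 v); split; try exact: component_homogeneous_part.
have Gyx : G 0 (1 - y * x).
  apply: componentB (component1 G) _; rewrite -[0 : int]addr0.
  exact: component_mul.
have := congr1 (part 0) uv1.
rewrite raddfD /= (homogeneous_partMl _ _ Gx) (homogeneous_partMl _ _ Gyx).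
by rewrite (homogeneous_part_component _ (component1 G)).
Qed.

(** If [M] contains every component of nonzero degree, then, modulo [M], each
element equals its part of degree 0, and [y * x] equals the product of the
parts of degree 0 of [y] and [x]: the products of parts of opposite nonzero
degrees are in [M] too, since their left factors are. *)
Lemma right_quasi_duo_of_degree0 :
    degree0_right_comaximal ->
    (forall M, graded_family G M -> forall x y, M (x * y - y * x)) ->
  right_quasi_duo R.
Proof.
move=> comax0 comm M maxM; have [Mr _ _] := maxM.
split=> //; split=> [|y x Mx]; first exact: Mr.1.
have [AM|] := pselect (graded_family G M).
  rewrite -[y * x](subrK (x * y)).
  by apply: right_idealD => //; [apply: comm|apply: Mr.2].
move=> /not_andP[//|notA].
have sub n z : n != 0 -> G n z -> M z.
  by move=> n0 Gz; apply: contrapT => Mz; apply: notA; exists n => // /(_ z Gz).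
have part0 z : M (z - part 0 z).
  have [s ->] := homogeneous_part_sum G z.
  rewrite raddf_sum -sumrB; apply: right_ideal_sum => // k _ /=.
  have Gk := component_homogeneous_part G k z.
  rewrite (homogeneous_part_component _ Gk).
  have [<-|k0] := eqVneq 0 k; first by rewrite subrr; apply: right_ideal0.
  by rewrite subr0; apply: sub Gk; rewrite eq_sym.
apply: contrapT => Myx; have [r] := maximal_right_ideal_gen 1 maxM Myx.
rewrite -mulrA => Myxr; have {Mx} Mxr : M (x * r) by apply: Mr.2.
set t := x * r in Myxr Mxr.
have Gy0 := component_homogeneous_part G 0 y.
have Gt0 := component_homogeneous_part G 0 t.
have My0t0 : M (1 - part 0 y * part 0 t).
  have /(right_idealD Mr Myxr) := Mr.2 _ t (part0 y).
  rewrite mulrBl addrA subrK => /(right_idealD Mr)/(_ (part0 (part 0 y * t))).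
  by rewrite (homogeneous_partMl _ _ Gy0) subrr addrA subrK.
have Mt0 : M (part 0 t).
  by have := right_idealB Mr Mxr (part0 t); rewrite subKr.
have [u [v [_ _ uv1]]] := comax0 _ _ Gt0 Gy0.
apply: (maximal_right_ideal1 maxM); rewrite -uv1.
by apply: right_idealD => //; apply: Mr.2.
Qed.

End GradedMaximalIdeals.

(** * Left-right symmetry of the graded radical *)

Section ConverseGrading.
Variables (R : pzRingType) (G : grading R).

Lemma converse_component_mul m n (x y : R^c) :
  G m x -> G n y -> G (m + n) (x * y).
Proof. by move=> Gx Gy; rewrite addrC; apply: component_mul. Qed.

Definition converse_grading : grading R^c :=
  @Grading R^c G (component_zmod G) converse_component_mul
    (component_span G) (@component_free _ G).

(** If [c] is outside [M], then [c] generates the simple module [R / M]. As [c]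
times any component of nonzero degree acts as zero, already the multiples of
[c] by degree 0 elements fill [R / M], and then [R_n] kills [R / M] for each
nonzero [n]. *)
Lemma graded_family_annihilator (M : set R) c :
    graded_family G M ->
    (forall n z M', n != 0 -> G n z -> maximal_right_ideal M' -> M' (c * z)) ->
  M c.
Proof.
move=> [maxM [n n0 nM]] Jc; apply: contrapT => Mc; apply: nM => y Gy.
have [Mr _ _] := maxM; have [r Mcr] := maximal_right_ideal_gen 1 maxM Mc.
rewrite -[y]mul1r -[1](subrK (c * r)) mulrDl.
apply: right_idealD => //; first exact: Mr.2.
have [s ->] := homogeneous_part_sum G r.
rewrite mulr_sumr mulr_suml; apply: right_ideal_sum => // k _.
have Gk := component_homogeneous_part G k r.
have [k0|k0] := eqVneq k 0; last by apply: Mr.2; apply: Jc Gk maxM.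
rewrite -mulrA; apply: (Jc n) => //.
by rewrite -[n]add0r; apply: component_mul; rewrite // -k0.
Qed.

(** A maximal right ideal outside the family contains [z] itself. *)
Lemma graded_radical_mull c n z (M : set R) :
    graded_radical G c -> n != 0 -> G n z -> maximal_right_ideal M ->
  M (z * c).
Proof.
move=> Ac n0 Gz maxM; have [AM|] := pselect (graded_family G M).
  exact: (graded_radical_ideal G).1.2 Ac M AM.
move=> /not_andP[//|notA]; have [Mr _ _] := maxM; apply: Mr.2.
by apply: contrapT => Mz; apply: notA; exists n => // /(_ z Gz).
Qed.

End ConverseGrading.

Lemma graded_radical_sub_converse (R : pzRingType) (G : grading R) :
  graded_radical G `<=` graded_radical (converse_grading G).
Proof.
move=> c Ac L AL; apply: (graded_family_annihilator AL).
move=> n z L' n0 Gz /maximal_left_ideal_converse maxL'.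
apply: (@jacobson_radical_right_left R ((z : R) * (c : R))) maxL' => M maxM.
exact: graded_radical_mull Ac n0 Gz maxM.
Qed.

Lemma graded_radical_converse (R : pzRingType) (G : grading R) :
  graded_radical (converse_grading G) = graded_radical G.
Proof.
apply/seteqP; split; last exact: (@graded_radical_sub_converse R G).
exact: (@graded_radical_sub_converse R^c (converse_grading G)).
Qed.

(** * The degree 0 ring and the quotient by the graded radical *)

Section Degree0AndQuotient.
Variables (R : pzRingType) (G : grading R).

Lemma right_quasi_duo_degree0P :
  right_quasi_duo (degree0_ring G) <-> degree0_right_comaximal G.
Proof.
rewrite right_quasi_duoP; split=> [xyP x y Gx Gy|comax0 x y].
  pose x0 : degree0_ring G := Sub x (mem_set Gx).
  pose y0 : degree0_ring G := Sub y (mem_set Gy).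
  have [u [v /(congr1 val)]] := xyP x0 y0.
  by exists (val u), (val v); split=> //; apply/set_mem/valP.
have [||u [v [Gu Gv uv1]]] := comax0 (val x) (val y).
- exact/set_mem/valP.
- exact/set_mem/valP.
exists (Sub u (mem_set Gu)), (Sub v (mem_set Gv)); exact: val_inj.
Qed.

Lemma left_quasi_duo_degree0P :
  left_quasi_duo (degree0_ring G) <->
  degree0_right_comaximal (converse_grading G).
Proof.
pose R0 := degree0_ring G; rewrite left_quasi_duo_converse right_quasi_duoP.
split=> [xyP x y Gx Gy|comax0 x y].
  pose x0 : R0 := Sub x (mem_set Gx).
  pose y0 : R0 := Sub y (mem_set Gy).
  have [u [v /(congr1 val)]] := xyP x0 y0.
  by exists (val (u : R0)), (val (v : R0)); split=> //; apply/set_mem/valP.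
have [||u [v [Gu Gv uv1]]] := comax0 (val (x : R0)) (val (y : R0)).
- exact/set_mem/valP.
- exact/set_mem/valP.
exists (Sub u (mem_set Gu) : R0), (Sub v (mem_set Gv) : R0).
exact: val_inj.
Qed.

Lemma commutative_graded_quotientP :
  commutative_ring (graded_quotient G) <->
  forall x y, graded_radical G (x * y - y * x).
Proof.
pose I2 := graded_radical_ideal G.
split=> [comm x y|comm x y].
  by apply/(quotient_eqE I2); rewrite !quotient_piM; apply: comm.
rewrite -[x]reprK -[y]reprK.
have := (quotient_eqE I2 (repr x * repr y) (repr y * repr x)).2 (comm _ _).
by rewrite !quotient_piM.
Qed.

End Degree0AndQuotient.

Lemma right_quasi_duo_graded (R : pzRingType) (G : grading R) :
  right_quasi_duo R <->
  degree0_right_comaximal G /\ forall x y, graded_radical G (x * y - y * x).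
Proof.
split=> [duoR|[comax0 comm]].
  split; first exact: right_quasi_duo_degree0.
  by move=> x y M; apply: right_quasi_duo_commutator.
by apply: right_quasi_duo_of_degree0 comax0 _ => M AM x y; apply: comm.
Qed.

Theorem theorem5 (R : pzRingType) (G : grading R) :
  (right_quasi_duo R <->
     right_quasi_duo (degree0_ring G) /\ commutative_ring (graded_quotient G))
  /\
  (left_quasi_duo R <->
     left_quasi_duo (degree0_ring G) /\ commutative_ring (graded_quotient G)).
Proof.
split.
  rewrite right_quasi_duo_degree0P commutative_graded_quotientP.
  exact: right_quasi_duo_graded.
rewrite left_quasi_duo_degree0P commutative_graded_quotientP.
rewrite left_quasi_duo_converse (right_quasi_duo_graded (converse_grading G)).
rewrite graded_radical_converse.
by split=> -[comax0 comm]; split=> // x y; apply: comm.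
Qed.
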